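(* Consider the generalized linear model described in the context and assume that Assumptions A.1, A.2, A.3 stated there hold, with $F$, $\mathcal{X}$, $M$ as in these assumptions. Associate with a pair $(\eta,y)\in\mathbf{R}^{n\times m}\times\mathbf{R}^m$ the vector field $$G_{(\eta,y)}(z)=\eta f(\eta^Tz)-\eta y:\ \mathbf{R}^n\to\mathbf{R}^n.$$ Then for every $x\in\mathcal{X}$ we have $$\begin{array}{rclr} \mathbf{E}_{(\eta,y)\sim P_x}\left\{G_{(\eta,y)}(z)\right\}&=&F(z)-F(x)\quad\forall z\in\mathbf{R}^n,&(a)\\ \|F(z)\|_2&\leq& M\quad\forall z\in\mathcal{X},&(b)\\ \mathbf{E}_{(\eta,y)\sim P_x}\left\{\|G_{(\eta,y)}(z)\|_2^2\right\}&\leq& 4M^2\quad\forall z\in\mathcal{X}.&(c) \end{array}$$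
   Context: Generalized linear model: $m,n$ are positive integers, $\mathcal{X}\subset\mathbf{R}^n$ is a given set of signals, and $f:\mathbf{R}^m\to\mathbf{R}^m$ is a given mapping. For each signal $x\in\mathcal{X}$, $P_x$ is a probability distribution of a random pair $\omega=(\eta,y)$ such that: (i) the regressor $\eta$ is a random $n\times m$ matrix whose (marginal) probability distribution $Q$ does not depend on $x$; (ii) the label $y$ is an $m$-dimensional random vector whose conditional expectation given $\eta$, under $P_x$, is $\mathbf{E}^x_{|\eta}\{y\}=f(\eta^Tx)$. Monotonicity: a vector field $g:\mathbf{R}^d\to\mathbf{R}^d$ is monotone if $[g(z)-g(z')]^T[z-z']\ge 0$ for all $z,z'\in\mathbf{R}^d$; it is monotone with modulus $\varkappa\ge0$ on a closed convex set $Z\subset\mathbf{R}^d$ if $[g(z)-g(z')]^T[z-z']\ge\varkappa\|z-z'\|_2^2$ for all $z,z'\in Z$. Assumptions: A.1. The vector field $f$ is continuous and monotone, and the vector field $F(z)=\mathbf{E}_{\eta\sim Q}\{\eta f(\eta^Tz)\}$ is well defined for all $z\in\mathbf{R}^n$ (i.e., the expectation exists and is finite; $F$ is then monotone). A.2. $\mathcal{X}$ is a nonempty convex compact set, and $F$ is monotone with positive modulus $\varkappa$ on $\mathcal{X}$. A.3. $M<\infty$ is such that $\mathbf{E}_{(\eta,y)\sim P_x}\{\|\eta y\|_2^2\}\le M^2$ for every $x\in\mathcal{X}$. *)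

(* Defs.v *)
From HB Require Import structures.
From mathcomp Require Import all_boot all_order all_algebra.
From mathcomp Require Import all_classical all_reals all_analysis.

Set Implicit Arguments.
Unset Strict Implicit.
Unset Printing Implicit Defensive.

Import Order.TTheory GRing.Theory Num.Theory.
Import numFieldNormedType.Exports.

Local Open Scope classical_set_scope.
Local Open Scope ring_scope.

(* p x q real matrices with their Borel sigma-algebra; as a type this unfolds
   to 'M[R]_(p, q). *)
Notation borelMx R p q := (g_sigma_algebraType (@open 'M[R]_(p, q))).

Section euclidean.
Context {R : realType} {d : nat}.
Implicit Types (u v z : 'cV[R]_d) (g : 'cV[R]_d -> 'cV[R]_d).

Definition dotv u v : R := (u^T *m v) 0 0.

(* The library's `|v| on 'cV[R]_d is the sup norm. *)
Definition norm2 v : R := Num.sqrt (\sum_(i < d) v i 0 ^+ 2).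

Definition monotone_field g : Prop :=
  forall z z', 0 <= dotv (g z - g z') (z - z').

Definition monotone_modulus (kappa : R) (Z : set 'cV[R]_d) g : Prop :=
  forall z z', Z z -> Z z' ->
    kappa * norm2 (z - z') ^+ 2 <= dotv (g z - g z') (z - z').

End euclidean.

Section vector_expectation.
Context {dT : measure_display} {T : measurableType dT} {R : realType}.
Context {k : nat}.
Implicit Types (P : probability T R) (V : T -> 'cV[R]_k).

Definition integrable_vec P V : Prop :=
  forall i, P.-integrable setT (fun w => (V w i 0)%:E).

Definition mean_vec P V : 'cV[R]_k := \col_i fine 'E_P[fun w => V w i 0].

End vector_expectation.

Section conditional_expectation.
Context {dT dS : measure_display} {T : measurableType dT}.
Context {S : measurableType dS} {R : realType}.
Variables (P : probability T R) (X : T -> S).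

Definition is_condexp_ge0 (Y : T -> R) (g : S -> R) : Prop :=
  [/\ measurable_fun setT g, (forall s, 0 <= g s) &
      forall A, measurable A ->
        (\int[P]_(w in X @^-1` A) (Y w)%:E =
         \int[P]_(w in X @^-1` A) (g (X w))%:E)%E].

(* h is a version of E[Y | X = .], taken in the general sense
   E[Y | X] = E[Y^+ | X] - E[Y^- | X] with both terms finite almost surely.
   When Y is integrable this is the usual conditional expectation; Y itself is
   not required to be integrable. *)
Definition is_condexp (Y : T -> R) (h : S -> R) : Prop :=
  exists gp gn : S -> R,
    [/\ is_condexp_ge0 Y^\+ gp, is_condexp_ge0 Y^\- gn &
        {ae P, forall w, h (X w) = gp (X w) - gn (X w)}].

End conditional_expectation.

Section generalized_linear_model.
Context {R : realType} {m n : nat}.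
Variable f : 'cV[R]_m -> 'cV[R]_m.

Definition glm (X : set 'cV[R]_n) (Q : probability (borelMx R n m) R)
    (P : 'cV[R]_n -> probability (borelMx R n m * borelMx R m 1)%type R) : Prop :=
  forall x, X x ->
    (forall A : set (borelMx R n m), measurable A -> P x (fst @^-1` A) = Q A) /\
    (forall i : 'I_m, is_condexp (P x) fst
       (fun w => (w.2 : 'cV[R]_m) i 0)
       (fun eta : borelMx R n m => f ((eta : 'M[R]_(n, m))^T *m x) i 0)).

Definition eta_f (z : 'cV[R]_n) (eta : borelMx R n m) : 'cV[R]_n :=
  (eta : 'M[R]_(n, m)) *m f ((eta : 'M[R]_(n, m))^T *m z).

Definition F_field (Q : probability (borelMx R n m) R) (z : 'cV[R]_n) : 'cV[R]_n :=
  mean_vec Q (eta_f z).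

Definition eta_y (w : borelMx R n m * borelMx R m 1) : 'cV[R]_n :=
  (w.1 : 'M[R]_(n, m)) *m (w.2 : 'cV[R]_m).

Definition G_field (w : borelMx R n m * borelMx R m 1) (z : 'cV[R]_n) : 'cV[R]_n :=
  eta_f z w.1 - eta_y w.

End generalized_linear_model.

(* Main.v *)
Require Import Defs.
From HB Require Import structures.
From mathcomp Require Import all_boot all_order all_algebra.
From mathcomp Require Import all_classical all_reals all_analysis.
From mathcomp Require Import measurable_realfun lra ring.
Import Order.TTheory GRing.Theory Num.Theory.
Import numFieldNormedType.Exports.
Local Open Scope classical_set_scope.
Local Open Scope ring_scope.
Import HBNNSimple.

(** Write V = eta y and H = eta f(eta^T x).  Since E(y | eta) = f(eta^T x),
    H is the conditional expectation of V given eta, coordinate by coordinate.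
    Hence E V = E H = F(x), which is (a), and by the conditional Jensen
    inequality E |H|^2 <= E |V|^2 <= M^2.  The law of eta is the same under all
    P_x, so the latter reads: the expectation of |eta f(eta^T z)|^2 under Q is
    at most M^2 for every z in X.  Jensen once more gives |F(z)|^2 <= M^2,
    which is (b); and |u - v|^2 <= 2 |u|^2 + 2 |v|^2 gives (c).

    The delicate point is the first sentence.  Neither the labels y_j nor the
    single products eta_kj y_j need be integrable: only their sum V_k is, so
    the factor eta_kj cannot be taken out of a conditional expectation term by
    term.  The remedy is to localise.  Everything is tested against weights
    psi(eta) that are small wherever some majorant K(eta) is large; for such
    weights all the terms are integrable and the pull-out property holds term
    by term.  This is [local_condexp], which is stable under sums and under
    multiplication by functions of eta ([local_condexp_lincomb]).  The weights
    1_{K <= N} then exhaust the whole space as N grows, and give back the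
    equality of means ([local_condexp_mean], by dominated convergence) and the
    Jensen inequality ([local_condexp_jensen], by monotone convergence). *)

(** * Localised conditional expectations *)

Section local_condexp.
Context {dT dS : measure_display} {T : measurableType dT} {S : measurableType dS} {R : realType}.
Context (P : probability T R) {X : T -> S}.
Hypothesis mX : measurable_fun setT X.

(** Taking a factor phi(X) out: the hypothesis is the case of indicators phi,
    hence the claim holds for simple phi, and monotone approximation by simple
    functions extends it, with both sides possibly infinite. *)
Lemma ge0_condexp_pullout (Y : T -> R) (g phi : S -> R) :
  measurable_fun setT Y -> (forall w, 0 <= Y w) ->
  measurable_fun setT g -> (forall s, 0 <= g s) ->
  (forall A, measurable A ->
    (\int[P]_(w in X @^-1` A) (Y w)%:E =
     \int[P]_(w in X @^-1` A) (g (X w))%:E)%E) ->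
  measurable_fun setT phi -> (forall s, 0 <= phi s) ->
  (\int[P]_w (phi (X w) * Y w)%:E = \int[P]_w (phi (X w) * g (X w))%:E)%E.
Proof.
move=> mY Y0 mg g0 Yg mphi phi0.
have mEphi : measurable_fun setT (fun s => (phi s)%:E) by exact/measurable_EFinP.
pose h := nnsfun_approx measurableT mEphi.
have mgX : measurable_fun setT (g \o X) by exact: measurableT_comp.
have mhX n : measurable_fun setT (h n \o X) by exact: measurableT_comp.
have limE (Z : T -> R) : measurable_fun setT Z -> (forall w, 0 <= Z w) ->
    (\int[P]_w (phi (X w) * Z w)%:E =
     limn (fun n => \int[P]_w (h n (X w) * Z w)%:E))%E.
  move=> mZ Z0; rewrite -monotone_convergence//=.
  - apply: eq_integral => w _; apply/esym/cvg_lim => //.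
    rewrite EFinM; under eq_fun do rewrite EFinM.
    by apply: cvgeZr => //; apply: cvg_nnsfun_approx => // s _; rewrite lee_fin.
  - by move=> n; apply/measurable_EFinP; apply: measurable_funM => //; exact: mhX.
  - by move=> n w _; rewrite lee_fin mulr_ge0.
  - move=> w _ a b ab; rewrite lee_fin ler_wpM2r//; exact/lefP/nd_nnsfun_approx.
rewrite limE// (limE (g \o X))//=; congr (limn _); apply/funext => n.
(* Both sides reduce, for simple phi, to integrals over level sets of phi. *)
have step (Z : T -> R) : measurable_fun setT Z -> (forall w, 0 <= Z w) ->
    (\int[P]_w (h n (X w) * Z w)%:E =
     \sum_(y \in range (h n)) y%:E *
       \int[P]_(w in X @^-1` (h n @^-1` [set y])) (Z w)%:E)%E.
  move=> mZ Z0.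
  have mpre y : measurable (X @^-1` (h n @^-1` [set y])).
    by rewrite -[_ @^-1` _]setTI; exact: mX.
  have mZr y : measurable_fun setT
      ((EFin \o Z) \_ (X @^-1` (h n @^-1` [set y]))).
    apply/(measurable_restrictT _ _).1 => //.
    by apply/measurable_EFinP; exact: measurable_funTS.
  transitivity (\int[P]_w (\sum_(y \in range (h n))
      (y%:E * ((EFin \o Z) \_ (X @^-1` (h n @^-1` [set y]))) w)))%E.
    apply: eq_integral => w _.
    rewrite [in LHS]fimfunE EFinM -fsumEFin// ge0_mule_fsuml; last first.
      by move=> y; exact: nnfun_muleindic_ge0.
    apply: eq_fsbigr => y _.
    by rewrite EFinM -muleA epatch_indic muleC [in RHS]muleC; congr (_ * _)%E; rewrite muleC.
  rewrite ge0_integral_fsum//; last 2 first.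
  - by move=> y; exact: measurable_funeM.
  - move=> y w _; rewrite epatch_indic muleCA mule_ge0 ?lee_fin//.
    exact: nnfun_muleindic_ge0.
  apply: eq_fsbigr => y; rewrite inE => -[s _ <-].
  rewrite ge0_integralZl ?lee_fin//; last first.
  - by move=> w _; apply: erestrict_ge0 => // ? _ /=; rewrite lee_fin.
  by rewrite [in RHS]integral_mkcond.
by rewrite !step//; apply: eq_fsbigr => r _; rewrite Yg.
Qed.

Lemma bounded_integrable (u : T -> R) (C : R) :
  measurable_fun setT u -> (forall w, `|u w| <= C) ->
  P.-integrable setT (fun w => (u w)%:E).
Proof.
move=> mu uC.
apply: (le_integrable _ _ _ (finite_measure_integrable_cst P C measurableT)) => //.
- exact/measurable_EFinP.
- by move=> w _ /=; rewrite lee_fin (le_trans (uC w))// ler_norm.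
Qed.

(** Integrability is only asked against weights that K controls, so neither V
    nor H(X) has to be integrable: for instance, a nonnegative finite-valued
    conditional expectation g of Y is local with K = g. *)
Definition local_condexp (V : T -> R) (H : S -> R) : Prop :=
  exists K : S -> R, [/\ measurable_fun setT K, forall s, 0 <= K s &
    forall (psi : S -> R) C, measurable_fun setT psi ->
      (forall s, `|psi s| * K s <= C) ->
      [/\ P.-integrable setT (fun w => (psi (X w) * V w)%:E),
          P.-integrable setT (fun w => (psi (X w) * H (X w))%:E) &
          (\int[P]_w (psi (X w) * V w)%:E =
           \int[P]_w (psi (X w) * H (X w))%:E)%E]].

(** With K = g the weighted psi(X) g(X) is bounded; the pull-out property for
    |psi| transfers its integrability to psi(X) Y, and applied to the positive
    and negative parts of psi it gives the equality of the integrals. *)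
Lemma local_condexp_ge0 (Y : T -> R) (g : S -> R) :
  measurable_fun setT Y -> (forall w, 0 <= Y w) ->
  measurable_fun setT g -> (forall s, 0 <= g s) ->
  (forall A, measurable A ->
    (\int[P]_(w in X @^-1` A) (Y w)%:E =
     \int[P]_(w in X @^-1` A) (g (X w))%:E)%E) ->
  local_condexp Y g.
Proof.
move=> mY Y0 mg g0 Yg; exists g; split=> // psi C mpsi psiC.
have mpX : measurable_fun setT (psi \o X) by exact: measurableT_comp.
have mgX : measurable_fun setT (g \o X) by exact: measurableT_comp.
have pull := @ge0_condexp_pullout Y g _ mY Y0 mg g0 Yg.
have Ig : P.-integrable setT (fun w => (psi (X w) * g (X w))%:E).
  apply: (@bounded_integrable _ C); first exact: measurable_funM.
  by move=> w; rewrite normrM (ger0_norm (g0 _)).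
split=> //.
- apply/integrableP; split.
    by apply/measurable_EFinP; apply: measurable_funM.
  move/integrableP: Ig => [_]; apply: le_lt_trans.
  under eq_integral do rewrite /= normrM (ger0_norm (Y0 _)).
  under [leRHS]eq_integral do rewrite /= normrM (ger0_norm (g0 _)).
  rewrite (pull (fun s => `|psi s|))//; exact: measurableT_comp.
- have posE (Z : T -> R) : (forall w, 0 <= Z w) ->
      (fun w => (psi (X w) * Z w)%:E)^\+%E =
      (fun w => (Num.max (psi (X w)) 0 * Z w)%:E).
    by move=> Z0; apply/funext => w; rewrite funeposE -EFin_max maxr_pMl// mul0r.
  have negE (Z : T -> R) : (forall w, 0 <= Z w) ->
      (fun w => (psi (X w) * Z w)%:E)^\-%E =
      (fun w => (Num.max (- psi (X w)) 0 * Z w)%:E).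
    move=> Z0; apply/funext => w.
    by rewrite funenegE -EFinN -EFin_max maxr_pMl// mul0r mulNr.
  rewrite integralE [RHS]integralE !posE// ?negE//; congr (_ - _)%E.
    apply: (pull (fun s => Num.max (psi s) 0)); last by move=> s; rewrite le_max lexx orbT.
    exact: measurable_maxr.
  apply: (pull (fun s => Num.max (- psi s) 0)); last by move=> s; rewrite le_max lexx orbT.
  by apply: measurable_maxr => //; exact: measurable_funN.
Qed.

Lemma local_condexp0 : local_condexp (fun=> 0) (fun=> 0).
Proof.
exists (fun=> 0); split=> // psi C _ _.
have -> : (fun w => (psi (X w) * 0)%:E) = cst 0%E.
  by apply/funext => w; rewrite mulr0.
by split=> //; exact: integrable0.
Qed.

Lemma local_condexpD V1 H1 V2 H2 :
  local_condexp V1 H1 -> local_condexp V2 H2 ->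
  local_condexp (fun w => V1 w + V2 w) (fun s => H1 s + H2 s).
Proof.
move=> [K1 [mK1 K10 h1]] [K2 [mK2 K20 h2]].
exists (fun s => K1 s + K2 s); split.
- exact: measurable_funD.
- by move=> s; rewrite addr_ge0.
move=> psi C mpsi psiC.
have [] := h1 psi C mpsi.
  by move=> s; rewrite (le_trans _ (psiC s))// ler_wpM2l// lerDl.
move=> IV1 IH1 E1.
have [] := h2 psi C mpsi.
  by move=> s; rewrite (le_trans _ (psiC s))// ler_wpM2l// lerDr.
move=> IV2 IH2 E2.
have DE A B : (fun w => (psi (X w) * (A w + B w))%:E) =
    (fun w => (psi (X w) * A w)%:E) \+ (fun w => (psi (X w) * B w)%:E).
  by apply/funext => w; rewrite mulrDr EFinD.
rewrite (DE V1 V2) (DE (H1 \o X) (H2 \o X)).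
split; [exact: integrableD|exact: integrableD|].
by rewrite !integralD// E1 E2.
Qed.

(** The new majorant |eta| K makes psi eta an admissible weight for (V, H)
    as soon as psi is one for the product. *)
Lemma local_condexpM (eta : S -> R) V H : measurable_fun setT eta ->
  local_condexp V H ->
  local_condexp (fun w => eta (X w) * V w) (fun s => eta s * H s).
Proof.
move=> meta [K [mK K0 h]].
exists (fun s => `|eta s| * K s); split.
- by apply: measurable_funM => //; exact: measurableT_comp.
- by move=> s; rewrite mulr_ge0.
move=> psi C mpsi psiC.
have ME A w : psi (X w) * (eta (X w) * A w) = psi (X w) * eta (X w) * A w.
  by rewrite mulrA.
have [||? ? E] := h (fun s => psi s * eta s) C.
- exact: measurable_funM.
- by move=> s; rewrite normrM -mulrA.
split.
- by under eq_fun do rewrite ME.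
- by under eq_fun do rewrite (ME (H \o X)).
- under eq_integral do rewrite ME; rewrite E.
  by under [RHS]eq_integral do rewrite (ME (H \o X)).
Qed.

Lemma local_condexp_sum (I : Type) (r : seq I) (V : I -> T -> R) (H : I -> S -> R) :
  (forall i, local_condexp (V i) (H i)) ->
  local_condexp (fun w => \sum_(i <- r) V i w) (fun s => \sum_(i <- r) H i s).
Proof.
move=> h; elim: r => [|i r ih].
  under [V in local_condexp V]eq_fun do rewrite big_nil.
  under [H in local_condexp _ H]eq_fun do rewrite big_nil.
  exact: local_condexp0.
under [V in local_condexp V]eq_fun do rewrite big_cons.
under [H in local_condexp _ H]eq_fun do rewrite big_cons.
exact: local_condexpD.
Qed.

(** Changes H(X) on a null set.  The measurability of H' has to be asked for,
    because the probability space need not be complete. *)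
Lemma local_condexp_ae V H H' : 
  measurable_fun setT H' ->
  {ae P, forall w, H' (X w) = H (X w)} ->
  local_condexp V H -> local_condexp V H'.
Proof.
move=> mH' HH' [K [mK K0 h]]; exists K; split=> // psi C mpsi psiC.
have [IV IH E] := h psi C mpsi psiC.
have mpH' : measurable_fun setT (fun w => (psi (X w) * H' (X w))%:E).
  apply/measurable_EFinP; apply: (@measurableT_comp _ _ _ _ _ _ (fun s => psi s * H' s)) => //.
  exact: measurable_funM.
have mpH := measurable_int _ IH.
have ae : ae_eq P setT (fun w => (psi (X w) * H' (X w))%:E) (fun w => (psi (X w) * H (X w))%:E).
  by apply: filterS HH' => w /= ->.
split=> //.
- move/integrableP: IH => [_ IH]; apply/integrableP; split=> //.
  apply: le_lt_trans IH; rewrite le_eqVlt; apply/orP; left; apply/eqP.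
  apply: ae_eq_integral => //; try exact: measurableT_comp.
  by apply: filterS HH' => w /= ->.
- by rewrite E; apply/esym/ae_eq_integral.
Qed.

(** The difference gp - gn of the conditional expectations of the two parts of Y
    is measurable; h, which is only almost surely equal to it, may fail to be. *)
Lemma is_condexp_local Y h : measurable_fun setT Y -> is_condexp P X Y h ->
  exists h', local_condexp Y h' /\ {ae P, forall w, h (X w) = h' (X w)}.
Proof.
move=> mY [gp [gn [[mgp gp0 Egp] [mgn gn0 Egn] hE]]].
exists (fun s => gp s + (-1) * gn s); split; last first.
  by apply: filterS hE => w ->; rewrite mulN1r.
have -> : Y = fun w => Y^\+ w + (-1) * Y^\- w.
  by apply/funext => w; rewrite mulN1r -[in LHS](funrposBneg Y).
apply: local_condexpD.
  by apply: local_condexp_ge0 => //; exact: measurable_funrpos.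
apply: (@local_condexpM (fun=> -1)) => //.
by apply: local_condexp_ge0 => //; exact: measurable_funrneg.
Qed.


(** Measurability is asked of the combination, and not of each h i: this is
    what the existence of the vector field F provides. *)
Lemma local_condexp_lincomb (I : finType) (Y : I -> T -> R) (h eta : I -> S -> R) :
  (forall i, measurable_fun setT (Y i)) ->
  (forall i, is_condexp P X (Y i) (h i)) ->
  (forall i, measurable_fun setT (eta i)) ->
  measurable_fun setT (fun s => \sum_i eta i s * h i s) ->
  local_condexp (fun w => \sum_i eta i (X w) * Y i w) (fun s => \sum_i eta i s * h i s).
Proof.
move=> mY ce meta mH.
have /choice[h' hh'] i := is_condexp_local _ _ (mY i) (ce i).
apply: (@local_condexp_ae _ (fun s => \sum_i eta i s * h' i s)) => //.
  have : {ae P, forall w, forall i, h i (X w) = h' i (X w)}.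
    by apply: filter_forall => i; have [] := hh' i.
  by apply: filterS => w hw; apply: eq_bigr => i _; rewrite hw.
apply: local_condexp_sum => i; apply: local_condexpM => //.
by have [] := hh' i.
Qed.

Lemma trunc_ge0 (K : S -> R) (c : R) s : 0 <= \1_[set t | K t <= c] s :> R.
Proof. by rewrite indicE ler0n. Qed.

Lemma measurable_trunc (K : S -> R) (c : R) : measurable_fun setT K ->
  measurable_fun setT (\1_[set t | K t <= c] : S -> R).
Proof.
move=> mK; apply: measurable_indic.
by rewrite -[X in measurable X]setTI; exact: measurable_fun_le.
Qed.

(** As K is finite everywhere, the sets [K <= N] exhaust the space. *)
Lemma integral_trunc_cvg (K : S -> R) (f : T -> R) :
  measurable_fun setT K -> P.-integrable setT (fun w => (f w)%:E) ->
  (\int[P]_w (\1_[set t | K t <= N%:R] (X w) * f w)%:E @[N --> \oo]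
    --> \int[P]_w (f w)%:E)%E.
Proof.
move=> mK If.
have mf : measurable_fun setT f by apply/measurable_EFinP; exact: measurable_int If.
have [|||||_ _ //] := @dominated_convergence _ _ _ P setT measurableT
  (fun N w => (\1_[set t | K t <= N%:R] (X w) * f w)%:E) (fun w => (f w)%:E)
  (fun w => `|f w|%:E).
- move=> N; apply/measurable_EFinP; apply: measurable_funM => //.
  by apply: measurableT_comp => //; exact: measurable_trunc.
- exact/measurable_EFinP.
- apply: aeW => w _; apply: cvg_near_cst.
  by apply: filterS (nbhs_infty_ger (K (X w))) => N hN; rewrite indicE mem_set ?mul1r.
- exact: integrable_norm.
- apply: aeW => w N _; rewrite lee_fin normrM indicE.
  by case: (_ \in _); rewrite ?normr1 ?mul1r// normr0 mul0r.
Qed.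

Lemma local_condexp_mean V H :
  P.-integrable setT (fun w => (V w)%:E) ->
  P.-integrable setT (fun w => (H (X w))%:E) ->
  local_condexp V H ->
  (\int[P]_w (V w)%:E = \int[P]_w (H (X w))%:E)%E.
Proof.
move=> IV IH [K [mK K0 h]].
have cV := @integral_trunc_cvg K V mK IV.
have cH := @integral_trunc_cvg K (H \o X) mK IH.
apply: (cvg_unique _ cV); rewrite //.
apply: cvg_trans cH; apply: near_eq_cvg; apply: nearW => N.
have [|_ _ ->//] := h _ N%:R (measurable_trunc _ N%:R mK).
move=> s; rewrite ger0_norm ?trunc_ge0// indicE.
have [|] := boolP (s \in _); last by rewrite mul0r.
by rewrite inE /= mul1r.
Qed.

(** Jensen's inequality for the square.  With the weight psi = tau H, where tau
    is the indicator of [K + |H| <= N], one gets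
    E (tau H^2) = E (tau H V) <= E (tau H^2) / 2 + E (V^2) / 2,
    where the left-hand side is finite and can be absorbed; then N grows. *)
Lemma local_condexp_jensen V H :
  measurable_fun setT V -> measurable_fun setT H ->
  local_condexp V H ->
  (\int[P]_w (H (X w) ^+ 2)%:E <= \int[P]_w (V w ^+ 2)%:E)%E.
Proof.
move=> mV mH [K [mK K0 h]].
have [->|Vfin] := eqVneq (\int[P]_w (V w ^+ 2)%:E)%E +oo%E; first exact: leey.
have mV2 : measurable_fun setT (fun w => V w ^+ 2) by exact: measurable_funX.
have IV : P.-integrable setT (fun w => (V w ^+ 2)%:E).
  apply/integrableP; split; first exact/measurable_EFinP.
  under eq_integral do rewrite /= ger0_norm ?sqr_ge0//.
  by rewrite ltey.
pose L s := K s + `|H s|.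
have mL : measurable_fun setT L.
  by apply: measurable_funD => //; exact: measurableT_comp.
pose tau N : S -> R := \1_[set t | L t <= N%:R].
have mtau N : measurable_fun setT (tau N) by exact: measurable_trunc.
have tau0 N s : 0 <= tau N s by exact: trunc_ge0.
have mXc (u : S -> R) : measurable_fun setT u -> measurable_fun setT (fun w => u (X w)).
  by move=> mu; exact: (measurableT_comp mu).
have mH2 : measurable_fun setT (fun s => H s ^+ 2) by exact: measurable_funX.
have HX : (\int[P]_w (tau N (X w) * H (X w) ^+ 2)%:E @[N --> \oo] -->
    \int[P]_w (H (X w) ^+ 2)%:E)%E.
  rewrite [X in _ --> X](_ : _ = \int[P]_w limn
    (fun N => (tau N (X w) * H (X w) ^+ 2)%:E))%E.
    apply: cvg_monotone_convergence => //=.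
    - move=> N; apply/measurable_EFinP.
      by apply: (mXc (fun s => tau N s * H s ^+ 2)); exact: measurable_funM.
    - by move=> N w _; rewrite lee_fin mulr_ge0// sqr_ge0.
    - move=> w _ a b ab; rewrite lee_fin ler_wpM2r ?sqr_ge0// /tau !indicE.
      have [|] := boolP (X w \in [set t | L t <= a%:R]); last by rewrite ler0n.
      rewrite inE /= => La; rewrite mem_set//=.
      by rewrite (le_trans La)// ler_nat.
  apply: eq_integral => w _; apply/esym/cvg_lim => //; apply: cvg_near_cst.
  by apply: filterS (nbhs_infty_ger (L (X w))) => N hN; rewrite /tau indicE mem_set ?mul1r.
rewrite -(cvg_lim _ HX)//; apply: lime_le.
  by apply/cvg_ex; eexists; exact: HX.
apply: nearW => N.
(* |psi| K <= N^2, since tau vanishes unless both |H| and K are at most N. *)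
have [||I1 I2 E] := h (fun s => tau N s * H s) (N%:R * N%:R).
- exact: measurable_funM.
- move=> s; rewrite normrM (ger0_norm (tau0 _ _)) /tau indicE.
  have [|] := boolP (s \in _); last by rewrite !mul0r mulr_ge0.
  rewrite inE /= mul1r => Ls; apply: ler_pM => //; apply: le_trans Ls.
    by rewrite lerDr.
  by rewrite lerDl.
have IH : P.-integrable setT (fun w => (tau N (X w) * H (X w) ^+ 2)%:E).
  by under eq_fun do rewrite expr2 mulrA.
have EH : (\int[P]_w (tau N (X w) * H (X w) ^+ 2)%:E =
    \int[P]_w (tau N (X w) * H (X w) * V w)%:E)%E.
  by rewrite E; apply: eq_integral => w _; rewrite expr2 mulrA.
set a := (\int[P]_w _)%E in EH *.
have afin : a \is a fin_num by exact: integrable_fin_num.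
have bfin : (\int[P]_w (V w ^+ 2)%:E)%E \is a fin_num by exact: integrable_fin_num.
have : (a <= \int[P]_w ((1 / 2)%:E * (tau N (X w) * H (X w) ^+ 2)%:E + (1 / 2)%:E * (V w ^+ 2)%:E))%E.
  rewrite EH; apply: le_integral => //.
    by apply: integrableD => //; exact: integrableZl.
  move=> w _; rewrite -!EFinM -EFinD lee_fin /tau indicE.
  have := sqr_ge0 (H (X w) - V w); have := sqr_ge0 (V w).
  by case: (_ \in _) => /=; nra.
rewrite integralD//; try exact: integrableZl.
rewrite !integralZl// -/a -(fineK afin) -(fineK bfin) -!EFinM -EFinD !lee_fin.
lra.
Qed.

End local_condexp.

(** * Measurability and second moments *)

Lemma measurable_entry (R : realType) {p q : nat} (i : 'I_p) (j : 'I_q) :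
  measurable_fun setT (fun A : borelMx R p q => (A : 'M[R]_(p, q)) i j).
Proof.
apply: (@measurability _ _ (borelMx R p q) R setT _ _ (RGenOpens.measurableE R)).
move=> _ [_ [x [y ->]] <-]; rewrite setTI; apply: sub_sigma_algebra.
apply: (@open_comp _ _ (fun A : 'M[R]_(p, q) => A i j)); last exact: interval_open.
by move=> A _; exact: coord_continuous.
Qed.

Lemma norm2_sqr (R : realType) d (v : 'cV[R]_d) :
  norm2 v ^+ 2 = \sum_(i < d) v i 0 ^+ 2.
Proof. by rewrite sqr_sqrtr// sumr_ge0// => i _; rewrite sqr_ge0. Qed.

Lemma eta_f_entry (R : realType) m n (f : 'cV[R]_m -> 'cV[R]_m) z
    (eta : borelMx R n m) k :
  eta_f f z eta k 0 =
  \sum_(j < m) (eta : 'M[R]_(n, m)) k j * f ((eta : 'M[R]_(n, m))^T *m z) j 0.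
Proof. by rewrite /eta_f mxE. Qed.

Lemma eta_y_entry (R : realType) m n (w : borelMx R n m * borelMx R m 1) k :
  eta_y w k 0 =
  \sum_(j < m) (w.1 : 'M[R]_(n, m)) k j * (w.2 : 'cV[R]_m) j 0.
Proof. by rewrite /eta_y mxE. Qed.

Lemma measurable_eta_y (R : realType) m n k :
  measurable_fun setT (fun w : borelMx R n m * borelMx R m 1 => eta_y w k 0).
Proof.
under eq_fun do rewrite eta_y_entry.
apply: measurable_sum => j; apply: measurable_funM.
  exact: (measurableT_comp (measurable_entry R k j) measurable_fst).
exact: (measurableT_comp (measurable_entry R j 0) measurable_snd).
Qed.

Lemma integral_sqr_ge0 {dT} {T : measurableType dT} {R : realType}
    (P : probability T R) (u : T -> R) :
  (0 <= \int[P]_w (u w ^+ 2)%:E)%E.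
Proof. by apply: integral_ge0 => w _; rewrite lee_fin sqr_ge0. Qed.

Lemma integral_sqrB_le {dT} {T : measurableType dT} {R : realType}
    (P : probability T R) (u v : T -> R) :
  measurable_fun setT u -> measurable_fun setT v ->
  (\int[P]_w ((u w - v w) ^+ 2)%:E <=
   2%:E * \int[P]_w (u w ^+ 2)%:E + 2%:E * \int[P]_w (v w ^+ 2)%:E)%E.
Proof.
move=> mu mv.
have m2 (t : T -> R) : measurable_fun setT t ->
    measurable_fun setT (fun w => (t w ^+ 2)%:E).
  by move=> mt; apply/measurable_EFinP; exact: measurable_funX.
have m22 (t : T -> R) : measurable_fun setT t ->
    measurable_fun setT (fun w => 2%:E * (t w ^+ 2)%:E)%E.
  by move=> mt; apply: measurable_funeM; exact: m2.
have dbl0 (t : T -> R) w : (0 <= 2%:E * (t w ^+ 2)%:E)%E.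
  by rewrite -EFinM lee_fin mulr_ge0 ?sqr_ge0.
have dbl (t : T -> R) : measurable_fun setT t ->
    (2%:E * \int[P]_w (t w ^+ 2)%:E = \int[P]_w (2%:E * (t w ^+ 2)%:E))%E.
  move=> mt; rewrite ge0_integralZl ?lee_fin//; first exact: m2.
  by move=> w _; rewrite lee_fin sqr_ge0.
rewrite !dbl// -ge0_integralD//; [|exact: m22|exact: m22].
apply: ge0_le_integral => //.
- by move=> w _; rewrite lee_fin sqr_ge0.
- by apply: (m2 (fun w => u w - v w)); exact: measurable_funB.
- by apply: emeasurable_funD; exact: m22.
- move=> w _; rewrite -!EFinM -EFinD lee_fin.
  by have := sqr_ge0 (u w + v w); lra.
Qed.

(** On a probability space L^2 is included in L^1, as |u| <= 1 + u^2. *)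
Lemma integrable_of_sqr {dT} {T : measurableType dT} {R : realType}
    (P : probability T R) (u : T -> R) :
  measurable_fun setT u -> (\int[P]_w (u w ^+ 2)%:E < +oo)%E ->
  P.-integrable setT (fun w => (u w)%:E).
Proof.
move=> mu u2.
have mu2 : measurable_fun setT (fun w => u w ^+ 2) by exact: measurable_funX.
have I2 : P.-integrable setT (fun w => (u w ^+ 2)%:E).
  apply/integrableP; split; first exact/measurable_EFinP.
  by under eq_integral do rewrite /= ger0_norm ?sqr_ge0//.
have I1 := finite_measure_integrable_cst P (1:R) measurableT.
apply: (le_integrable measurableT _ _ (integrableD measurableT I1 I2)).
  exact/measurable_EFinP.
move=> w _ /=; rewrite lee_fin [leRHS]ger0_norm ?addr_ge0 ?sqr_ge0//.
rewrite -(real_normK (num_real (u w))).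
by have := sqr_ge0 (`|u w| - 1); nra.
Qed.

(** The mean is the conditional expectation given a constant, so this is a
    case of the conditional Jensen inequality. *)
Lemma sqr_mean_le {dT} {T : measurableType dT} {R : realType}
    (P : probability T R) (u : T -> R) :
  P.-integrable setT (fun w => (u w)%:E) ->
  (((\int[P]_w u w)%R ^+ 2)%:E <= \int[P]_w (u w ^+ 2)%:E)%E.
Proof.
move=> Iu; have mu : measurable_fun setT u.
  by apply/measurable_EFinP; exact: measurable_int Iu.
pose c := (\int[P]_w u w)%R.
have lc : local_condexp P (X := fun=> tt) u (fun=> c).
  exists (fun=> 0); split=> // psi C _ _; split.
  - by under eq_fun do rewrite EFinM; exact: integrableZl.
  - exact: finite_measure_integrable_cst.
  - under eq_integral do rewrite EFinM.
    rewrite integralZl// integral_cst//= probability_setT mule1.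
    by rewrite EFinM /c /Rintegral fineK//; exact: integrable_fin_num.
have := @local_condexp_jensen _ _ _ _ _ P (fun=> tt) _ u (fun=> c) mu _ lc.
rewrite integral_cst//= probability_setT mule1; apply => //; exact: measurable_cst.
Qed.

Lemma expectation_norm2_sqr {dT} {T : measurableType dT} {R : realType}
    (P : probability T R) d (V : T -> 'cV[R]_d) :
  (forall i, measurable_fun setT (fun w => V w i 0)) ->
  ('E_P[fun w => (norm2 (V w) ^+ 2)%R] = \sum_(i < d) \int[P]_w (V w i 0 ^+ 2)%:E)%E.
Proof.
move=> mV; rewrite unlock.
under eq_integral do rewrite norm2_sqr -sumEFin.
rewrite ge0_integral_sum//.
- by move=> i; apply/measurable_EFinP; exact: measurable_funX.
- by move=> i w _; rewrite lee_fin sqr_ge0.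
Qed.

(** * The generalized linear model *)

Section model.
Context {R : realType} {m n : nat} {f : 'cV[R]_m -> 'cV[R]_m}.
Context {Q : probability (borelMx R n m) R}.
Context (P : probability (borelMx R n m * borelMx R m 1)%type R).
Hypothesis marginal : forall A : set (borelMx R n m), measurable A -> P (fst @^-1` A) = Q A.

Lemma ge0_integral_marginal (u : borelMx R n m -> \bar R) :
  measurable_fun setT u -> (forall eta, 0 <= u eta)%E ->
  (\int[P]_w u w.1 = \int[Q]_eta u eta)%E.
Proof.
move=> mu u0.
rewrite (eq_measure_integral (pushforward P fst)); last first.
  by move=> A mA _; apply/esym; exact: marginal.
by rewrite ge0_integral_pushforward// => eta _.
Qed.

Lemma integrable_marginal (u : borelMx R n m -> R) :
  Q.-integrable setT (fun eta => (u eta)%:E) ->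
  P.-integrable setT (fun w => (u w.1)%:E).
Proof.
move=> Iu; have mu := measurable_int _ Iu.
apply/integrableP; split; first exact: (measurableT_comp mu).
rewrite (@ge0_integral_marginal (fun eta => `|(u eta)%:E|)%E)//.
- by move/integrableP: Iu => [].
- exact: measurableT_comp.
Qed.

Lemma integral_marginal (u : borelMx R n m -> R) :
  Q.-integrable setT (fun eta => (u eta)%:E) ->
  (\int[P]_w (u w.1)%:E = \int[Q]_eta (u eta)%:E)%E.
Proof.
move=> Iu; have mu := measurable_int _ Iu.
rewrite [RHS](eq_measure_integral (pushforward P fst)); last first.
  by move=> A mA _; apply/esym; exact: marginal.
rewrite integral_pushforward//; exact: integrable_marginal.
Qed.

(** Each coordinate of eta y is a combination of the labels whose coefficients,
    the entries of eta, are functions of the regressor. *)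
Lemma eta_y_local_condexp x k :
  (forall i : 'I_m, is_condexp P fst
       (fun w => (w.2 : 'cV[R]_m) i 0)
       (fun eta : borelMx R n m => f ((eta : 'M[R]_(n, m))^T *m x) i 0)) ->
  measurable_fun setT (fun eta => eta_f f x eta k 0) ->
  local_condexp P (X := fst) (fun w => eta_y w k 0) (fun eta => eta_f f x eta k 0).
Proof.
move=> ce mH.
have my i : measurable_fun setT
    (fun w : borelMx R n m * borelMx R m 1 => (w.2 : 'cV[R]_m) i 0).
  exact: (measurableT_comp (measurable_entry R i 0) measurable_snd).
under [H in local_condexp _ _ H]eq_fun do rewrite eta_f_entry.
under [V in local_condexp _ V]eq_fun do rewrite eta_y_entry.
apply: (@local_condexp_lincomb _ _ _ _ _ P fst measurable_fst _ _ _
  (fun j (eta : borelMx R n m) => (eta : 'M[R]_(n, m)) k j) my ce).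
  by move=> j; exact: measurable_entry.
by under eq_fun do rewrite -eta_f_entry.
Qed.
End model.
Theorem proposition3p1 (R : realType) (m n : nat) (m_gt0 : (0 < m)%N)
    (n_gt0 : (0 < n)%N)
    (X : set 'cV[R]_n) (f : 'cV[R]_m -> 'cV[R]_m)
    (Q : probability (borelMx R n m) R)
    (P : 'cV[R]_n -> probability (borelMx R n m * borelMx R m 1)%type R)
    (model : glm f X Q P)
    (A1_continuous : continuous f)
    (A1_monotone : monotone_field f)
    (A1_F_defined : forall z : 'cV[R]_n, integrable_vec Q (eta_f f z))
    (A2_nonempty : X !=set0)
    (A2_convex : convex_set X)
    (A2_compact : compact X)
    (kappa : R) (kappa_gt0 : 0 < kappa)
    (A2_modulus : monotone_modulus kappa X (F_field f Q))
    (M : R) (M_ge0 : 0 <= M)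
    (A3 : forall x, X x ->
      ('E_(P x)[fun w => (norm2 (eta_y w) ^+ 2)%R] <= (M ^+ 2)%:E)%E) :
  forall x, X x ->
    [/\ (forall z : 'cV[R]_n,
           integrable_vec (P x) (fun w => G_field f w z) /\
           mean_vec (P x) (fun w => G_field f w z)
             = F_field f Q z - F_field f Q x),
        (forall z, X z -> norm2 (F_field f Q z) <= M) &
        (forall z, X z ->
           ('E_(P x)[fun w => (norm2 (G_field f w z) ^+ 2)%R]
              <= (4 * M ^+ 2)%:E)%E)].

Proof.
have mH (z : 'cV[R]_n) k : measurable_fun setT (fun eta : borelMx R n m => eta_f f z eta k 0).
  by apply/measurable_EFinP; exact: measurable_int (A1_F_defined z k).
have mHP (z : 'cV[R]_n) k : measurable_fun setT
    (fun w : borelMx R n m * borelMx R m 1 => eta_f f z w.1 k 0).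
  exact: (measurableT_comp (mH z k) measurable_fst).
have mV k := @measurable_eta_y R m n k.
have EV x : X x -> (\sum_(k < n) \int[P x]_w (eta_y w k 0 ^+ 2)%:E <= (M ^+ 2)%:E)%E.
  by move=> Xx; rewrite -expectation_norm2_sqr//; exact: A3.
have lc x k : X x ->
    local_condexp (P x) (X := fst) (fun w => eta_y w k 0) (fun eta => eta_f f x eta k 0).
  by move=> Xx; apply: eta_y_local_condexp => //; have [] := model x Xx.
have EH x : X x -> (\sum_(k < n) \int[Q]_eta (eta_f f x eta k 0 ^+ 2)%:E <= (M ^+ 2)%:E)%E.
  move=> Xx; apply: le_trans (EV x Xx); apply: lee_sum => k _.
  rewrite -(@ge0_integral_marginal _ _ _ _ (P x) _ (fun eta => (eta_f f x eta k 0 ^+ 2)%:E)).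
  - apply: (@local_condexp_jensen _ _ _ _ _ (P x) fst _ _ (fun eta => eta_f f x eta k 0)) => //.
    exact: lc.
  - by have [] := model x Xx.
  - by apply/measurable_EFinP; exact: measurable_funX.
  - by move=> eta; rewrite lee_fin sqr_ge0.
move=> x Xx; have [marg _] := model x Xx.
have IV k : (P x).-integrable setT (fun w => (eta_y w k 0)%:E).
  apply: integrable_of_sqr => //; apply: le_lt_trans (ltry (M ^+ 2)).
  apply: le_trans (EV x Xx).
  rewrite (bigD1 k)//= leeDl// sume_ge0// => i _.
  by apply: integral_ge0 => w _; rewrite lee_fin sqr_ge0.
have IH (z : 'cV[R]_n) k : (P x).-integrable setT (fun w => (eta_f f z w.1 k 0)%:E).
  exact: (@integrable_marginal _ _ _ _ _ marg (fun eta => eta_f f z eta k 0) (A1_F_defined z k)).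
have GE (z : 'cV[R]_n) k w : G_field f w z k 0 = eta_f f z w.1 k 0 - eta_y w k 0.
  by rewrite /G_field !mxE.
split.
- move=> z; split=> [k|].
    by under eq_fun do rewrite GE EFinB; exact: integrableB.
  apply/colP => k; rewrite !mxE unlock.
  under eq_integral do rewrite GE EFinB.
  rewrite integralB// fineB; try exact: integrable_fin_num.
  congr (_ - _); congr fine.
    exact: (@integral_marginal _ _ _ _ _ marg (fun eta => eta_f f z eta k 0) (A1_F_defined z k)).
  rewrite (@local_condexp_mean _ _ _ _ _ (P x) fst _ _ (fun eta => eta_f f x eta k 0))//.
    exact: (@integral_marginal _ _ _ _ _ marg (fun eta => eta_f f x eta k 0) (A1_F_defined x k)).
  exact: lc.
- move=> z Xz; rewrite -(@ler_pXn2r _ 2)//; last by rewrite nnegrE sqrtr_ge0.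
  rewrite norm2_sqr -lee_fin; apply: le_trans (EH z Xz).
  rewrite -sumEFin; apply: lee_sum => k _.
  by rewrite !mxE unlock; exact: (sqr_mean_le _ _ (A1_F_defined z k)).
- move=> z Xz; rewrite expectation_norm2_sqr; last first.
    by move=> k; under eq_fun do rewrite GE; exact: measurable_funB.
  have -> : (4 * M ^+ 2)%:E = (2%:E * (M ^+ 2)%:E + 2%:E * (M ^+ 2)%:E)%E.
    by rewrite -!EFinM -EFinD; congr (_%:E); ring.
  apply: le_trans (leeD (lee_wpmul2l _ (EH z Xz)) (lee_wpmul2l _ (EV x Xx))) => //.
  rewrite !ge0_sume_distrr; try by move=> *; exact: integral_sqr_ge0.
  rewrite -big_split /=; apply: lee_sum => k _.
  rewrite -(@ge0_integral_marginal _ _ _ _ (P x) marg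
    (fun eta => (eta_f f z eta k 0 ^+ 2)%:E)); last 2 first.
  - by apply/measurable_EFinP; exact: measurable_funX.
  - by move=> eta; rewrite lee_fin sqr_ge0.
  under eq_integral do rewrite GE.
  exact: (integral_sqrB_le _ _ _ (mHP z k) (mV k)).
Qed.
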